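(* Let $P,Q\in\mathbb{C}[x,y]$ be polynomials of degree $m>1$ without a common nonconstant polynomial factor. Assume that the system $\dot x=P(x,y)$, $\dot y=Q(x,y)$ admits a smooth algebraic invariant curve $C\subset\mathbb{C}\mathbb{P}^2$ defined by the equation $f(x,y)=0$, $\deg(f)=n$. Then $$n\leq m+1.$$
   Context: An algebraic invariant curve of the system is the curve $C\subset\mathbb{C}\mathbb{P}^2$ (projective closure) of the affine equation $f(x,y)=0$, where $f\in\mathbb{C}[x,y]$ is an irreducible (nonconstant) polynomial such that $P\frac{\partial f}{\partial x}+Q\frac{\partial f}{\partial y}=kf$ for some $k\in\mathbb{C}[x,y]$. Smooth means that $C$ has no singular points in $\mathbb{C}\mathbb{P}^2$ (including points at infinity). *)

(* Defs.v *)
From mathcomp Require Import all_boot all_order all_algebra.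
From mathcomp Require Import complex.
From mathcomp Require Import reals.
From mathcomp Require Import mpoly.

Set Implicit Arguments.
Unset Strict Implicit.
Unset Printing Implicit Defensive.

Import GRing.Theory.
Local Open Scope ring_scope.

Section PlaneCurves.
Variable K : fieldType.

(* The zero polynomial gets degree 0. *)
Definition mdegree (n : nat) (p : {mpoly K[n]}) : nat := (msize p).-1.

Definition nonconstant (n : nat) (p : {mpoly K[n]}) : Prop :=
  (0 < mdegree p)%N.

Definition mirreducible (n : nat) (p : {mpoly K[n]}) : Prop :=
  nonconstant p /\
  forall g h : {mpoly K[n]}, p = g * h -> ~ nonconstant g \/ ~ nonconstant h.

Definition no_common_factor (n : nat) (p q : {mpoly K[n]}) : Prop :=
  ~ exists g p1 q1 : {mpoly K[n]},
      [/\ nonconstant g, p = g * p1 & q = g * q1].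

(* The affine coordinates are x = 'X_ord0 and y = 'X_ord_max. *)
Definition invariant_curve (P Q f : {mpoly K[2]}) : Prop :=
  mirreducible f /\
  exists k : {mpoly K[2]}, P * f^`M(ord0) + Q * f^`M(ord_max) = k * f.

(* Z ^ deg f * f (X_0 / Z, ..., X_(n-1) / Z), where Z is the last variable. *)
Definition homogenization (n : nat) (f : {mpoly K[n]}) : {mpoly K[n.+1]} :=
  \sum_(a <- msupp f)
    mwiden (f@_a *: 'X_[a]) * 'X_ord_max ^+ (mdegree f - mdeg a)%N.

(* A point of the projective plane is given by homogeneous coordinates v that
   are not all zero; the conditions below do not depend on their choice. *)
Definition proj_point (v : 'I_3 -> K) : Prop := exists i, v i != 0.

(* The projective closure of the affine curve f = 0. *)
Definition on_proj_closure (f : {mpoly K[2]}) (v : 'I_3 -> K) : Prop :=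
  proj_point v /\ (homogenization f).@[v] = 0.

(* The Jacobian criterion describes the singular points of the curve only for
   square-free f; it is used for irreducible f. *)
Definition singular_point (f : {mpoly K[2]}) (v : 'I_3 -> K) : Prop :=
  on_proj_closure f v /\
  forall i : 'I_3, ((homogenization f)^`M(i)).@[v] = 0.

Definition smooth_curve (f : {mpoly K[2]}) : Prop :=
  forall v : 'I_3 -> K, ~ singular_point f v.

End PlaneCurves.

(* Main.v *)
From HB Require Import structures.
Require Import Defs.
From mathcomp Require Import all_boot all_order all_algebra.
From mathcomp Require Import complex reals mpoly.
From mathcomp Require Import ring.

(** Let F, A, B, G be the homogenizations of f, P, Q and of the cofactor k,
    with n = deg f.  The invariance of the curve becomes
    A F_x + B F_y = G F, and Euler's identity x F_x + y F_y + z F_z = n F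
    turns this into a linear relation between the partial derivatives of F,

      (n A - x G) F_x + (n B - y G) F_y - z G F_z = 0,

    whose coefficients are forms of degree m.  Smoothness says that the three
    partials, which are forms of degree n - 1, have no common projective zero
    ([smooth_gradient]).  Three such forms in three variables are a regular
    sequence, so that all relations between them are generated by the obvious
    ones F_j * F_i - F_i * F_j = 0, and there is no nonzero relation with
    coefficients of degree less than n - 1 ([no_small_syzygy]).  Hence n > m + 1
    would give z G = 0, then G = 0 and A = B = 0, although P and Q are not both
    zero.

    The property of regular sequences is proved in two steps.

    First, the ideal of the three forms contains a power of every variable
    ([var_power_in_ideal]).  Setting one variable to 1, this says that three
    polynomials in two variables without common zero generate the unit ideal.
    One of them may be taken monic in one of the two variables, and then a
    determinant argument in the style of Nakayama's lemma eliminates that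
    variable ([poly2_nullstellensatz]).

    Second, the powers X^N, Y^N, Z^N are a regular sequence for elementary
    reasons: membership in an ideal generated by powers of variables is read
    off from the exponents of the monomials ([varpow_idealP]).  An ideal
    generated by three elements which contains a regular sequence of length
    three has only Koszul relations between its generators ([koszul]); a
    degree count concludes. *)

Set Implicit Arguments.
Unset Strict Implicit.
Unset Printing Implicit Defensive.

Import GRing.Theory.
Local Open Scope ring_scope.

(** * Nullstellensatz in one and two variables *)

(** An ideal is a predicate, so that one may speak of the elimination ideal and
    of the image of an ideal under evaluation without choosing generators. *)
Definition ideal (A : comNzRingType) (I : A -> Prop) : Prop :=
  (exists p, I p) /\ forall u p q, I p -> I q -> I (u * p + q).

Section IdealTheory.
Variables (A : comNzRingType) (I : A -> Prop).
Hypothesis hI : ideal I.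

Lemma ideal0 : I 0.
Proof.
case: hI => [[p Ip] IA]; have := IA (-1) _ _ Ip Ip.
by rewrite mulN1r addNr.
Qed.

Lemma idealMl u p : I p -> I (u * p).
Proof. by move=> Ip; have := hI.2 u _ _ Ip ideal0; rewrite addr0. Qed.

Lemma idealD p q : I p -> I q -> I (p + q).
Proof. by move=> Ip Iq; have := hI.2 1 _ _ Ip Iq; rewrite mul1r. Qed.

Lemma ideal_sum n (F : 'I_n -> A) : (forall i, I (F i)) -> I (\sum_i F i).
Proof. by move=> IF; apply: big_ind => //; [exact: ideal0 | exact: idealD]. Qed.

End IdealTheory.

Lemma ideal_span (A : comNzRingType) n (F : 'I_n -> A) :
  ideal (fun p => exists c : 'I_n -> A, p = \sum_j c j * F j).
Proof.
split; first by exists (\sum_j 0 * F j), (fun=> 0).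
move=> u _ _ [c ->] [e ->]; exists (fun j => u * c j + e j).
rewrite mulr_sumr -big_split /=; apply: eq_bigr => j _.
by rewrite mulrDl mulrA.
Qed.

Section Null.
Variable K : closedFieldType.

(** A nonconstant element [h] of the ideal can always be replaced by a smaller
    nonzero one: some [g] in the ideal does not vanish at a given root of [h],
    so the remainder of [g] by [h] is not zero. *)
Lemma poly_nullstellensatz (J : {poly K} -> Prop) :
  ideal J -> (forall a, exists2 p, J p & p.[a] != 0) -> J 1.
Proof.
move=> hJ Jnz.
have step s (h : {poly K}) : (size h <= s)%N -> h != 0 -> J h -> J 1.
  elim: s h => [|s IH] h; first by rewrite leqn0 size_poly_eq0 => ->.
  move=> hs h0 Jh.
  have [h1|h1] := boolP (size h == 1%N).
    have /size_poly1P [c c0 hc] := h1.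
    have := idealMl hJ (c^-1)%:P Jh.
    by rewrite hc -polyCM mulVf.
  have /closed_rootP [a ra] := h1.
  have [g Jg ga] := Jnz a.
  apply: (IH (g %% h)).
  - by rewrite -ltnS (leq_trans _ hs) // ltn_modp.
  - apply: contra ga => /eqP g0.
    by rewrite (divp_eq g h) g0 addr0 hornerM (rootP ra) mulr0.
  - have -> : g %% h = - (g %/ h) * h + g.
      by rewrite {3}(divp_eq g h) mulNr addKr.
    exact: hJ.2.
have [p Jp p0] := Jnz 0.
apply: (step (size p) p) => //; apply: contra p0 => /eqP ->.
by rewrite horner0.
Qed.

(** It suffices to find, for each [a], an element of the elimination ideal
    (the [h] such that [h%:P] is in [I]) that does not vanish at [a].  At the
    fixed value [a] of the first variable, the one-variable case gives 1 in [I]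
    modulo 'X - a.  Since [g] is monic up to a unit, the quotient by [I] is
    generated by finitely many powers of the second variable as a module over
    {poly K}, and it is equal to ('X - a) times itself; the determinant trick
    then gives an element of {poly K} that kills the quotient and takes the
    value 1 at [a]. *)
Lemma poly2_nullstellensatz (I : {poly {poly K}} -> Prop)
    (g : {poly {poly K}}) :
  ideal I -> I g -> lead_coef g \is a GRing.unit ->
  (forall a b, exists2 p, I p & p.[b%:P].[a] != 0) -> I 1.
Proof.
move=> hI Ig gu Inz.
suff : I (1%:P) by [].
apply: (@poly_nullstellensatz (fun h => I h%:P)).
  split; first by exists 0; rewrite polyC0; exact: ideal0.
  by move=> u p q Ip Iq; rewrite polyCD polyCM; apply: hI.2.
move=> a.
pose ev : {rmorphism {poly K} -> K} := horner_eval a.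
(* The elements of I, evaluated at a, form an ideal of {poly K} without zero. *)
have [g0 Ig0 g01] : exists2 p, I p & map_poly ev p = 1.
  apply: (@poly_nullstellensatz (fun q => exists2 p, I p & map_poly ev p = q)).
    split; first by exists (map_poly ev 0), 0 => //; exact: ideal0.
    move=> u _ _ [p Ip <-] [q Iq <-].
    exists (map_poly polyC u * p + q); first exact: hI.2.
    rewrite rmorphD rmorphM /= -map_poly_comp /=; congr (_ * _ + _).
    by apply: map_poly_id => x _; rewrite /= /horner_eval hornerC.
  move=> b; have [p Ip pab] := Inz a b.
  exists (map_poly ev p); first by exists p.
  have -> : b = ev b%:P by rewrite /= /horner_eval hornerC.
  by rewrite horner_map.
have [w hw] : exists w, 1 - g0 = ('X - a%:P)%:P * w.
  exists (\poly_(i < size (1 - g0)) ((1 - g0)`_i %/ ('X - a%:P))).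
  apply/polyP => i; rewrite coefCM coef_poly.
  case: ltnP => hi; last by rewrite mulr0 nth_default.
  rewrite mulrC divpK //  dvdp_XsubCl; apply/rootP.
  have -> : ((1 - g0)`_i).[a] = (map_poly ev (1 - g0))`_i by rewrite coef_map.
  by rewrite rmorphB rmorph1 /= g01 subrr coef0.
(* The size of g, not its degree, bounds the exponents: this makes the matrix
   nonempty even when g is constant. *)
pose n := size g.
have gn0 : g != 0 by apply: contraTneq gu => ->; rewrite lead_coef0 unitr0.
have n0 : (0 < n)%N by rewrite size_poly_gt0.
pose rem (i : nat) := (('X^i * w) %% g)%R.
pose M : 'M[{poly K}]_n :=
  \matrix_(i, j) ((i == j)%:R - ('X - a%:P) * (rem i)`_j).
(* Modulo I, the vector of powers of 'X is killed by M, and M is the identity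
   matrix modulo 'X - a. *)
have row i : I (\sum_j (M i j)%:P * 'X^j).
  have -> : \sum_j (M i j)%:P * 'X^j =
    'X^i * g0 + ('X - a%:P)%:P * ((('X^i * w) %/ g) * g).
    have E : \sum_j (M i j)%:P * 'X^j = 'X^i - ('X - a%:P)%:P * rem i.
      have hr : (size (rem i) <= n)%N by rewrite ltnW // ltn_modp.
      have remE : rem i = \sum_(j < n) (rem i)`_j *: 'X^j.
        rewrite -poly_def; apply/polyP => k; rewrite coef_poly.
        by case: ltnP => // hk; rewrite nth_default //; exact: leq_trans hk.
      rewrite [X in _ - _ * X]remE.
      rewrite mulr_sumr.
      have -> : ('X^i : {poly {poly K}}) = \sum_(j < n) (i == j)%:R%:P * 'X^j.
        rewrite (bigD1 i) //= eqxx mul1r big1 ?addr0 // => j /negPf hj.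
        by rewrite eq_sym hj mul0r.
      rewrite -sumrB; apply: eq_bigr => j _.
      by rewrite mxE polyCB polyCM mulrBl -mul_polyC mulrA.
    rewrite E.
    have := Pdiv.IdomainUnit.divp_eq gu ('X^i * w).
    rewrite -/(rem i) => /esym /eqP.
    rewrite eq_sym -subr_eq => /eqP <-.
    have -> : g0 = 1 - ('X - a%:P)%:P * w by rewrite -hw opprB addrC subrK.
    rewrite mulrBr mulr1 mulrBr mulrCA; ring.
  apply: idealD => //; first exact: idealMl.
  by rewrite mulrA; exact: idealMl.
exists (\det M).
  have -> : (\det M)%:P =
    \sum_i (\adj M (Ordinal n0) i)%:P * \sum_j (M i j)%:P * 'X^j.
    under eq_bigr => i _ do rewrite mulr_sumr.
    rewrite exchange_big /=.
    have H j : \sum_i (\adj M (Ordinal n0) i)%:P * ((M i j)%:P * 'X^j) =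
      ((\det M) *+ (Ordinal n0 == j))%:P * 'X^j.
      have <- : (\adj M *m M) (Ordinal n0) j = (\det M) *+ (Ordinal n0 == j).
        by rewrite mul_adj_mx mxE.
      rewrite mxE rmorph_sum mulr_suml; apply: eq_bigr => i _.
      by rewrite /= polyCM mulrA.
    rewrite (eq_bigr _ (fun j _ => H j)) (bigD1 (Ordinal n0)) // big1 => [|j].
      by rewrite mulr1n expr0 mulr1 /= addr0.
    by rewrite eq_sym => /negPf ->; rewrite mulr0n mul0r.
  by apply: ideal_sum => // i; exact: idealMl.
have -> : (\det M).[a] = ev (\det M) by [].
rewrite -det_map_mx.
have -> : map_mx ev M = 1%:M.
  apply/matrixP => i j; rewrite !mxE rmorphB rmorphM /= rmorph_nat.
  by rewrite /horner_eval hornerXsubC subrr mul0r subr0.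
by rewrite det1 oner_eq0.
Qed.
End Null.

(** * Homogenization and dehomogenization *)

Section Dehom.
Variables (n : nat) (K : fieldType).
Implicit Types (p q : {mpoly K[n]}) (m : 'X_{1..n}) (i j : 'I_n).

(** The variable [i] is set to 1, but the polynomial ring is kept, so that no
    renumbering of the other variables is needed. *)
Definition dehom i p : {mpoly K[n]} :=
  mmap (@mpolyC n K) (fun j => if j == i then 1 else 'X_j) p.

HB.instance Definition _ i := GRing.RMorphism.copy (dehom i)
  (mmap (@mpolyC n K) (fun j => if j == i then 1 else 'X_j)).

Definition mnm_erase i m : 'X_{1..n} :=
  [multinom (if j == i then 0%N else m j) | j < n].

Lemma dehomX i m : dehom i 'X_[m] = 'X_[mnm_erase i m].
Proof.
rewrite /dehom mmapX /mmap1 mpolyXE_id; apply: eq_bigr => j _.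
by rewrite mnmE; case: eqP; rewrite ?expr1n.
Qed.

Lemma dehomZ i c p : dehom i (c *: p) = c *: dehom i p.
Proof. by rewrite /dehom mmapZ mul_mpolyC. Qed.

Lemma dehomE i p : dehom i p = \sum_(m <- msupp p) p@_m *: 'X_[mnm_erase i m].
Proof.
rewrite {1}[p]mpolyE rmorph_sum; apply: eq_bigr => m _ /=.
by rewrite dehomZ dehomX.
Qed.

(** The erased exponent is recovered from the degree. *)
Lemma mnm_erase_inj i m1 m2 :
  mdeg m1 = mdeg m2 -> mnm_erase i m1 = mnm_erase i m2 -> m1 = m2.
Proof.
rewrite !mdegE !(bigD1 (P := predT) i) //= => hdeg /mnmP he.
have hj j : j != i -> m1 j = m2 j.
  by move=> /negPf ji; have := he j; rewrite !mnmE ji.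
apply/mnmP => j; have [->|/hj //] := eqVneq j i.
move: hdeg; rewrite (eq_bigr m2) => [|k /hj //].
by move/addIn.
Qed.

(** Identities between forms of the same degree may thus be checked after
    setting a variable to 1. *)
Lemma dehom_inj i d p : p \is d.-homog -> dehom i p = 0 -> p = 0.
Proof.
move=> hp p0; apply/mpolyP => m; rewrite mcoeff0.
have [->//|pm] := eqVneq p@_m 0.
have mp : m \in msupp p by rewrite mcoeff_msupp.
have <- : (dehom i p)@_(mnm_erase i m) = 0 by rewrite p0 mcoeff0.
rewrite dehomE raddf_sum (bigD1_seq m) ?msupp_uniq //=.
rewrite mcoeffZ mcoeffX eqxx mulr1 big_seq_cond big1 ?addr0 //.
move=> k /andP[kp km].
rewrite mcoeffZ mcoeffX; case: eqP => [/mnm_erase_inj kE|_].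
  by case/eqP: km; apply: kE; rewrite !(dhomog_mf hp).
by rewrite mulr0.
Qed.

Definition homog_at i d p : {mpoly K[n]} :=
  \sum_(m <- msupp p) p@_m *: 'X_[m + U_(i) *+ (d - mdeg m)].

Lemma homog_at_homog i d p : (msize p <= d.+1)%N -> homog_at i d p \is d.-homog.
Proof.
move=> hp; rewrite /homog_at big_seq; apply: rpred_sum => m /msize_mdeg_lt hm.
apply: dhomogZ; rewrite dhomogX /= mdegD mdegMn mdeg1 mul1n subnKC //.
by rewrite -ltnS (leq_trans hm).
Qed.

Lemma dehom_homog_at i d p : dehom i (homog_at i d p) = dehom i p.
Proof.
rewrite [RHS]dehomE /homog_at rmorph_sum; apply: eq_bigr => m _ /=.
rewrite dehomZ dehomX; congr (_ *: 'X_[_]); apply/mnmP => j.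
rewrite !mnmE; case: (eqVneq j i) => // /negPf ji.
by rewrite mulmnE mnm1E eq_sym ji mul0n addn0.
Qed.

Lemma dehom_mderiv i j p : j != i -> dehom i p^`M(j) = (dehom i p)^`M(j).
Proof.
move=> /negPf ji; rewrite [dehom i p]dehomE {1}/mderiv rmorph_sum linear_sum /=.
apply: eq_bigr => m _.
rewrite dehomZ dehomX mderivZ mderivX mnmE ji scalerA mulrC.
congr (_ *: 'X_[_]).
apply/mnmP => k; rewrite !mnmE.
by case: (k =P i) => // ->; rewrite ji.
Qed.

Lemma dhomog_mderiv d j p : p \is d.+1.-homog -> p^`M(j) \is d.-homog.
Proof.
move=> hp; apply/dhomogP => m; rewrite mcoeff_msupp mcoeff_deriv.
apply: contraNeq => hm; rewrite (dhomog_nemf_coeff hp) ?mul0rn //.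
by rewrite /= mdegD mdeg1 addn1 eqSS.
Qed.

Lemma euler_dhomog d p : p \is d.-homog -> \sum_j 'X_j * p^`M(j) = p *+ d.
Proof.
move=> hp; rewrite /mderiv [p in RHS]mpolyE -sumrMnl.
under eq_bigr => j _ do rewrite mulr_sumr.
rewrite exchange_big /= big_seq [RHS]big_seq; apply: eq_bigr => m mp.
rewrite -(dhomog_mf hp mp) /= mdegE -sumrMnr; apply: eq_bigr => j _.
rewrite -scalerAr -mpolyXD mulr_natl -scalerMnl.
case: (posnP (m j)) => [->|mj]; first by rewrite !mulr0n.
rewrite addmC submK //; apply/mnm_lepP => k.
by rewrite mnm1E; case: eqP => [<-|].
Qed.

(** Multiplication by a form of degree [d] creates only monomials of degree at
    least [d]. *)
Lemma dhomog_ideal_small e d r (F a : 'I_r -> {mpoly K[n]}) p :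
  (forall j : 'I_r, F j \is d.-homog) -> p \is e.-homog -> (e < d)%N ->
  p = \sum_(j : 'I_r) a j * F j -> p = 0.
Proof.
move=> hF hp ed pE; apply/mpolyP => m; rewrite mcoeff0.
have [he|he] := eqVneq (mdeg m) e; last exact: dhomog_nemf_coeff hp he.
rewrite pE raddf_sum big1 // => j _ /=.
rewrite mcoeffM big1 // => -[k1 k2] /= /eqP mE.
rewrite (dhomog_nemf_coeff (hF j)) ?mulr0 // neq_ltn.
suff -> : (mdeg k2 < d)%N by [].
have k2e : (mdeg k2 <= mdeg m)%N.
  by rewrite [X in (_ <= mdeg X)%N]mE mdegD leq_addl.
by apply: leq_ltn_trans k2e _; rewrite he.
Qed.
End Dehom.

Lemma dehomK n (K : fieldType) (i : 'I_n) (p : {mpoly K[n]}) :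
  dehom i (dehom i p) = dehom i p.
Proof.
rewrite [dehom i p in LHS]dehomE rmorph_sum [RHS]dehomE.
apply: eq_bigr => m _ /=.
rewrite dehomZ dehomX; congr (_ *: 'X_[_]); apply/mnmP => j.
by rewrite !mnmE; case: (j == i).
Qed.

Lemma dehom_var n (K : fieldType) (i : 'I_n) : dehom i 'X_i = 1 :> {mpoly K[n]}.
Proof. by rewrite /dehom mmapX mmap1U eqxx. Qed.

Section Widen.
Variables (n : nat) (K : fieldType).
Implicit Types (p : {mpoly K[n]}).
Local Notation widen := (widen_ord (leqnSn n)).

Lemma mwiden_msupp p :
  mwiden p = \sum_(m <- msupp p) p@_m *: 'X_[mnmwiden m].
Proof.
rewrite {1}[p]mpolyE raddf_sum; apply: eq_bigr => m _ /=.
by rewrite mwidenZ mwidenX.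
Qed.

Lemma dehom_mwiden p : dehom ord_max (mwiden p) = mwiden p.
Proof.
rewrite mwiden_msupp rmorph_sum; apply: eq_bigr => m _ /=.
rewrite dehomZ dehomX; congr (_ *: 'X_[_]); apply/mnmP => j.
by rewrite mnmE; case: eqP => // ->; rewrite mnmwiden_ordmax.
Qed.

Lemma mderiv_mwiden p j : (mwiden p)^`M(widen j) = mwiden p^`M(j).
Proof.
rewrite mwiden_msupp linear_sum /mderiv raddf_sum; apply: eq_bigr => m _ /=.
rewrite mderivZ mderivX mwidenZ mwidenX mnmwiden_widen scalerA mulrC.
congr (_ *: 'X_[_]); apply/mnmP => k; rewrite mnmBE.
case: (unliftP ord_max k) => [k' ->|->].
  have -> : lift ord_max k' = widen k' by apply: val_inj; exact: lift_max.
  by rewrite !mnmwiden_widen mnmBE !mnm1E.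
by rewrite !mnmwiden_ordmax.
Qed.

Lemma mdeg_mnmwiden (m : 'X_{1..n}) : mdeg (mnmwiden m) = mdeg m.
Proof.
rewrite !mdegE big_ord_recr /= mnmwiden_ordmax addn0.
by apply: eq_bigr => i _; rewrite mnmwiden_widen.
Qed.


Lemma homogenization_homog p : homogenization p \is (mdegree p).-homog.
Proof.
rewrite /homogenization big_seq; apply: rpred_sum => m /msize_mdeg_lt hm.
rewrite mwidenZ mwidenX -scalerAl mpolyXn -mpolyXD; apply: dhomogZ.
rewrite dhomogX /= mdegD mdegMn mdeg1 mul1n mdeg_mnmwiden subnKC //.
by rewrite /mdegree -ltnS; exact: leq_trans hm (leqSpred _).
Qed.

Lemma dehom_homogenization p : dehom ord_max (homogenization p) = mwiden p.
Proof.
rewrite [RHS]mwiden_msupp rmorph_sum; apply: eq_bigr => m _ /=.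
rewrite rmorphM rmorphXn /= dehom_mwiden.
by rewrite dehom_var expr1n mulr1 mwidenZ mwidenX.
Qed.

Lemma msize_mwiden p : (msize (mwiden p) <= msize p)%N.
Proof.
rewrite mwiden_msupp.
apply: leq_trans (msize_sum _ _ _) _; apply/bigmax_leqP_seq => m mp _.
apply: leq_trans (msizeZ_le _ _) _.
by rewrite msizeX mdeg_mnmwiden msize_mdeg_lt.
Qed.
End Widen.

(** * Powers of the variables in the ideal of forms without common zero *)

Lemma rmorph_mmap n (R S T : comNzRingType) (f : R -> S) (h : 'I_n -> S)
    (g : {rmorphism S -> T}) (p : {mpoly R[n]}) :
  g (mmap f h p) = mmap (g \o f) (g \o h) p.
Proof.
rewrite /mmap rmorph_sum; apply: eq_bigr => m _.
rewrite rmorphM rmorph_prod; congr (_ * _).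
by apply: eq_bigr => j _; rewrite rmorphXn.
Qed.

Lemma eq_mmap n (R S : comNzRingType) (f f' : R -> S) (h h' : 'I_n -> S)
    (p : {mpoly R[n]}) :
  f =1 f' -> h =1 h' -> mmap f h p = mmap f' h' p.
Proof.
move=> ff hh; rewrite /mmap; apply: eq_bigr => m _.
by rewrite ff (mmap1_eq _ hh).
Qed.

Section Chart.
Variables (K : closedFieldType) (i k l : 'I_3).
Hypothesis ikl : uniq [:: i; k; l].
Implicit Types (p q : {mpoly K[3]}).

Let ik : (i == k) = false.
Proof. by move: ikl; rewrite /= !inE; do 3!case: eqP. Qed.
Let il : (i == l) = false.
Proof. by move: ikl; rewrite /= !inE; do 3!case: eqP. Qed.
Let kl : (k == l) = false.
Proof. by move: ikl; rewrite /= !inE; do 3!case: eqP. Qed.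

Let ki : (k == i) = false.
Proof. by rewrite eq_sym. Qed.
Let li : (l == i) = false.
Proof. by rewrite eq_sym. Qed.

Let ord3P (P : 'I_3 -> Prop) : P i -> P k -> P l -> forall t, P t.
Proof.
move=> Pi Pk Pl t.
have : t \in [:: i; k; l].
  have := uniq_leq_size ikl (s2 := enum 'I_3) (fun x _ => mem_enum _ x).
  have [||_ ->] := uniq_min_size ikl (s2 := enum 'I_3).
  - by move=> x _; rewrite mem_enum.
  - by rewrite size_enum_ord.
  by rewrite mem_enum.
by rewrite !inE => /or3P[] /eqP ->.
Qed.

(** The affine chart where the variable [i] is 1, with coordinates [k] (inner)
    and [l] (outer).  The ring is {poly {poly K}} because the elimination uses
    Euclidean division with respect to one variable. *)
Definition chart_var (t : 'I_3) : {poly {poly K}} :=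
  if t == l then 'X else (if t == i then 1 else 'X)%:P.

Definition chart p : {poly {poly K}} := mmap (polyC \o polyC) chart_var p.

HB.instance Definition _ := GRing.RMorphism.copy chart
  (mmap (polyC \o polyC : {rmorphism K -> {poly {poly K}}}) chart_var).

Definition unchart1 : {poly K} -> {mpoly K[3]} :=
  horner_eval 'X_k \o map_poly (@mpolyC 3 K).
HB.instance Definition _ := GRing.RMorphism.on unchart1.
Definition unchart : {poly {poly K}} -> {mpoly K[3]} :=
  horner_eval 'X_l \o map_poly unchart1.
HB.instance Definition _ := GRing.RMorphism.on unchart.

Lemma chartK p : unchart (chart p) = dehom i p.
Proof.
rewrite [unchart _]rmorph_mmap; apply: eq_mmap => [c|].
  rewrite /= /unchart /= map_polyC /= /horner_eval hornerC /unchart1 /=.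
  by rewrite map_polyC /= /horner_eval hornerC.
have C c : unchart c%:P = unchart1 c.
  by rewrite /unchart /= map_polyC /= /horner_eval hornerC.
have C1 : unchart1 'X = 'X_k.
  by rewrite /unchart1 /= map_polyX /horner_eval hornerX.
apply: ord3P; rewrite [LHS]/= /chart_var.
- by rewrite il eqxx C rmorph1.
- by rewrite kl ki C C1.
- by rewrite eqxx li /unchart /= map_polyX /horner_eval hornerX.
Qed.

Lemma chart_eval p a b :
  (chart p).[b%:P].[a] =
  p.@[fun t => if t == l then b else if t == i then 1 else a].
Proof.
have -> : (chart p).[b%:P].[a] =
  (horner_eval a \o horner_eval b%:P) (chart p) by [].
rewrite rmorph_mmap; apply: eq_mmap => [c|t] /=.
  by rewrite /horner_eval !hornerC.
rewrite /chart_var; case: eqP => _.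
  by rewrite /horner_eval hornerX hornerC.
by rewrite /horner_eval hornerC; case: eqP => _; rewrite ?hornerC ?hornerX.
Qed.

Lemma coef_chart p s : (chart p)`_s =
  \sum_(m <- msupp p) (p@_m)%:P *
     (\prod_(t | t != l) (if t == i then 1 else 'X) ^+ m t) *+ (m l == s).
Proof.
rewrite /chart /mmap coef_sum; apply: eq_bigr => m _ /=.
rewrite coefCM -mulrnAr; congr (_ * _).
rewrite /mmap1 (bigD1 l) //= {1}/chart_var eqxx.
rewrite (eq_bigr (fun t => ((if t == i then 1 else 'X) ^+ m t)%:P)).
  by rewrite -rmorph_prod /= coefMC coefXn eq_sym mulr_natl.
by move=> t /negPf tl; rewrite /chart_var tl rmorphXn.
Qed.

(** A form of degree [d] which does not vanish at the coordinate point of [l]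
    contains the monomial 'X_l ^+ d, and no other monomial of it has that degree
    in 'X_l: it is monic in 'X_l up to a scalar. *)
Lemma chart_lead d p : p \is d.-homog ->
  p.@[fun t => (t == l)%:R] != 0 -> lead_coef (chart p) \is a GRing.unit.
Proof.
move=> hp pl.
(* Some monomial of p does not vanish at the coordinate point of l. *)
have [m0 m0p m00] : exists2 m, m \in msupp p & forall t, t != l -> m t = 0%N.
  move: pl; rewrite mevalE => pl.
  have [/hasP[m mp /forall_inP hm]|/hasPn H] :=
    boolP (has (fun m : 'X_{1..3} => [forall (t | t != l), m t == 0%N])
               (msupp p)).
    by exists m => // t /hm /eqP.
  case/eqP: pl; rewrite big_seq big1 // => m /H; rewrite negb_forall_in.
  case/exists_inP => t /negPf tl mt.
  by rewrite (bigD1 t) //= tl expr0n (negPf mt) mul0r mulr0.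
have mld m : m \in msupp p -> (m l + \sum_(t | t != l) m t)%N = d.
  by move=> /(dhomog_mf hp) /= <-; rewrite mdegE [RHS](bigD1 l).
have m0l : m0 l = d.
  by rewrite -(mld _ m0p) big1 ?addn0.
have cd : (chart p)`_d = (p@_m0)%:P.
  rewrite coef_chart (bigD1_seq m0) ?msupp_uniq //= m0l eqxx mulr1n.
  rewrite big1 => [|t /m00 ->]; last by rewrite expr0.
  rewrite mulr1 big_seq_cond big1 ?addr0 // => m /andP[mp mm0].
  case: eqP => // ml; case/eqP: mm0.
  have /eqP := mld _ mp; rewrite ml -[X in _ == X]addn0 eqn_add2l sum_nat_eq0.
  move=> /forall_inP H; apply/mnmP => t; have [->|tl] := eqVneq t l.
    by rewrite ml m0l.
  by rewrite m00 //; apply/eqP/H.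
have sz : (size (chart p) <= d.+1)%N.
  apply/leq_sizeP => s ds; rewrite coef_chart big_seq big1 // => m /mld hm.
  by rewrite ltn_eqF // (leq_ltn_trans _ ds) // -hm leq_addr.
have pm0 : p@_m0 != 0 by rewrite -mcoeff_msupp.
have -> : lead_coef (chart p) = (p@_m0)%:P.
  rewrite /lead_coef; suff -> : size (chart p) = d.+1 by [].
  apply/eqP; rewrite eqn_leq sz /= ltnNge.
  apply/negP => /leq_sizeP /(_ d (leqnn d)).
  by rewrite cd => /eqP; rewrite polyC_eq0 (negPf pm0).
by rewrite rmorph_unit // unitfE.
Qed.

(** As the coordinate point of [l] is not a common zero, one of the forms is
    monic in 'X_l up to a scalar, and the two-variable Nullstellensatz applies
    in the chart.  Homogenizing the resulting expression of 1 gives a power of 'X_i. *)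
Lemma var_power_in_ideal_chart d r (F : 'I_r -> {mpoly K[3]}) :
  (forall j, F j \is d.-homog) ->
  (forall v, proj_point v -> exists j, (F j).@[v] != 0) ->
  exists N, exists a : 'I_r -> {mpoly K[3]}, 'X_i ^+ N = \sum_j a j * F j.
Proof.
move=> hF nz.
have [j0 hj0] : exists j, (F j).@[fun t => (t == l)%:R] != 0.
  by apply: nz; exists l; rewrite eqxx oner_neq0.
have hI := ideal_span (fun j => chart (F j)).
have inI j : exists c : 'I_r -> {poly {poly K}},
    chart (F j) = \sum_j c j * chart (F j).
  exists (fun t => (t == j)%:R).
  rewrite (bigD1 j) //= eqxx mul1r big1 ?addr0 //.
  by move=> t /negPf ->; rewrite mul0r.
have [|c hc] := poly2_nullstellensatz hI (inI j0) (chart_lead (hF j0) hj0).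
  move=> a b.
  have [|j hj] :=
    nz (fun t => if t == l then b else if t == i then 1 else a).
    by exists i; rewrite il eqxx oner_neq0.
  by exists (chart (F j)); [exact: inI | rewrite chart_eval].
pose N := (\max_j msize (unchart (c j)))%N.
exists (N + d)%N, (fun j => homog_at i N (unchart (c j))).
apply/eqP; rewrite -subr_eq0; apply/eqP.
apply: (@dehom_inj _ _ i (N + d)).
  apply: rpredB.
    have := dhomogMn (d := 1) (p := 'X_i : {mpoly K[3]}) (N + d) .
    by rewrite mul1n; apply; rewrite dhomogX /= mdeg1.
  apply: rpred_sum => j _; apply: dhomogM => //.
  apply: homog_at_homog; apply: leqW; rewrite /N.
  exact: (@leq_bigmax _ (fun j => msize (unchart (c j))) j).
rewrite rmorphB rmorphXn /= dehom_var expr1n rmorph_sum /=.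
have /(congr1 (dehom i \o unchart)) := hc.
rewrite /= rmorph1 rmorph1 !rmorph_sum /= => {1}->.
apply/eqP; rewrite subr_eq0; apply/eqP; apply: eq_bigr => j _.
by rewrite !rmorphM /= dehom_homog_at chartK dehomK.
Qed.
End Chart.

Lemma var_power_in_ideal (K : closedFieldType) d r (F : 'I_r -> {mpoly K[3]}) :
  (forall j, F j \is d.-homog) ->
  (forall v, proj_point v -> exists j, (F j).@[v] != 0) ->
  exists N, forall i, exists a : 'I_r -> {mpoly K[3]},
    'X_i ^+ N = \sum_j a j * F j.
Proof.
move=> hF nz.
have H i : exists N, exists a : 'I_r -> {mpoly K[3]},
    'X_i ^+ N = \sum_j a j * F j.
  have [k [l u]] : exists k l, uniq [:: i; k; l].
    case: i => -[|[|[|//]]] hi.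
    - by exists (inord 1), (inord 2); rewrite /= !inE -!val_eqE /= !inordK.
    - by exists (inord 0), (inord 2); rewrite /= !inE -!val_eqE /= !inordK.
    - by exists (inord 0), (inord 1); rewrite /= !inE -!val_eqE /= !inordK.
  exact: (var_power_in_ideal_chart u hF nz).
have [N HN] := fin_all_exists H.
exists (\max_i N i)%N => i; have [a ha] := HN i.
exists (fun j => 'X_i ^+ (\max_i N i - N i) * a j).
have le : (N i <= \max_i N i)%N by exact: (@leq_bigmax _ N i).
rewrite -{1}(subnK le) exprD ha mulr_sumr.
by apply: eq_bigr => j _; rewrite mulrA.
Qed.

(** * Relations between generators of an ideal *)

Section VarPowers.
Variables (n : nat) (K : fieldType).
Implicit Types (c : {mpoly K[n]}) (m : 'X_{1..n}) (A : pred 'I_n).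

Lemma mcoeff_varpow_mul i N c m :
  ('X_i ^+ N * c)@_m = if (N <= m i)%N then c@_(m - U_(i) *+ N) else 0.
Proof.
rewrite mpolyXn mulrC.
case: ifP => Nm.
  have {1}-> : m = (m - U_(i) *+ N + U_(i) *+ N)%MM.
    rewrite submK //; apply/mnm_lepP => j; rewrite mulmnE mnm1E.
    by case: eqP => [<-|]; rewrite ?mul1n.
  by rewrite addmC mcoeffMX.
rewrite mcoeffM big1 // => -[k1 k2] /= /eqP mE.
rewrite mcoeffX; case: eqP => [kE|]; last by rewrite mulr0.
have mi : m i = (k1 i + N)%N.
  by rewrite {1}mE mnmDE -kE mulmnE mnm1E eqxx mul1n.
by rewrite mi leq_addl in Nm.
Qed.

(** Membership is tested monomial by monomial: the cofactors are built by
    assigning each monomial of [c] to one variable of [A] whose power divides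
    it. *)
Lemma varpow_idealP A N c :
  (exists p : 'I_n -> {mpoly K[n]}, c = \sum_(i | A i) 'X_i ^+ N * p i) <->
  (forall m, c@_m != 0 -> exists2 i, A i & (N <= m i)%N).
Proof.
split=> [[p ->] m|H].
  rewrite raddf_sum /= => cm.
  have [/exists_inP //|/exists_inPn h] :=
    boolP [exists (i | A i), (N <= m i)%N].
  case/eqP: cm; apply: big1 => i /h /negPf.
  by rewrite mcoeff_varpow_mul => ->.
pose sel m := [pick i | A i && (N <= m i)%N].
exists (fun i => \sum_(m <- msupp c | sel m == Some i)
  c@_m *: 'X_[m - U_(i) *+ N]).
under eq_bigr => i _ do rewrite mulr_sumr big_mkcond.
rewrite exchange_big /= {1}[c]mpolyE big_seq [RHS]big_seq; apply: eq_bigr => m.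
rewrite mcoeff_msupp => /H [i0 Ai0 Ni0].
case E: (sel m) => [i|]; last first.
  by move: E; rewrite /sel; case: pickP => // /(_ i0); rewrite Ai0 Ni0.
have /andP[Ai Ni] : A i && (N <= m i)%N.
  by move: E; rewrite /sel; case: pickP => // j Hj [<-].
rewrite (bigD1 i) //= eqxx big1 => [|j /andP[_ /negPf ji]]; last first.
  by case: eqP => // -[ij]; rewrite ij eqxx in ji.
rewrite addr0 -scalerAr mpolyXn -mpolyXD addmC submK //.
apply/mnm_lepP => j; rewrite mulmnE mnm1E.
by case: eqP => [<-|]; rewrite ?mul1n.
Qed.

Lemma varpow_regular A N l c (p : 'I_n -> {mpoly K[n]}) :
  ~~ A l -> 'X_l ^+ N * c = \sum_(i | A i) 'X_i ^+ N * p i ->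
  exists q : 'I_n -> {mpoly K[n]}, c = \sum_(i | A i) 'X_i ^+ N * q i.
Proof.
move=> Al hc; apply/varpow_idealP => m cm.
have [H _] := varpow_idealP A N ('X_l ^+ N * c).
have [|i Ai] := H (ex_intro _ p hc) (m + U_(l) *+ N)%MM.
  by rewrite mcoeff_varpow_mul mnmDE mulmnE mnm1E eqxx mul1n leq_addl addmK.
rewrite mnmDE mulmnE mnm1E.
have -> : (l == i) = false by apply: contraNF Al => /eqP ->.
by rewrite mul0n addn0 => ?; exists i.
Qed.
End VarPowers.

(** A regular sequence in the weak sense: (x, y, z) may be the unit ideal. *)
Definition regular3 (S : comNzRingType) (x y z : S) : Prop :=
  [/\ forall c, x * c = 0 -> c = 0,
      forall c p, y * c = x * p -> exists p', c = x * p' &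
      forall c p q, z * c = x * p + y * q -> exists p' q', c = x * p' + y * q'].

(** Let F and U be the vectors of generators and of coefficients, so that
    U.F = 0, let a, b, e express x, y, z by F, and write ^ for the cross
    product.  From F ^ (U ^ a) = (F.a) U - (F.U) a one gets x U = F ^ V with
    V = U ^ a.  Hence F ^ V vanishes modulo x, and the same identity gives
    y V = c F modulo x, where c = b.V.  Then c F = 0 modulo (x, y), so z c
    is in (x, y), and so is c by regularity, say c = x p + y q.  Now
    y (V - q F) is a multiple of x, hence V - q F = x T for some T, and
    x U = F ^ V = x (F ^ T). *)
Lemma koszul (S : comNzRingType) (x y z F0 F1 F2 U0 U1 U2 : S) :
  let I t := exists a0 a1 a2, t = a0 * F0 + a1 * F1 + a2 * F2 in
  regular3 x y z -> I x -> I y -> I z ->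
  U0 * F0 + U1 * F1 + U2 * F2 = 0 ->
  exists T0 T1 T2, [/\ U0 = F1 * T2 - F2 * T1, U1 = F2 * T0 - F0 * T2 &
                       U2 = F0 * T1 - F1 * T0].
Proof.
move=> /= [rx ry rz] [a0 [a1 [a2 hx]]] [b0 [b1 [b2 hy]]] [e0 [e1 [e2 hz]]] hU.
pose V0 := U1 * a2 - U2 * a1.
pose V1 := U2 * a0 - U0 * a2.
pose V2 := U0 * a1 - U1 * a0.
have xU0 : x * U0 = F1 * V2 - F2 * V1.
  rewrite /V1 /V2 hx -[LHS]subr0 -[0](mulr0 a0) -hU; ring.
have xU1 : x * U1 = F2 * V0 - F0 * V2.
  rewrite /V0 /V2 hx -[LHS]subr0 -[0](mulr0 a1) -hU; ring.
have xU2 : x * U2 = F0 * V1 - F1 * V0.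
  rewrite /V0 /V1 hx -[LHS]subr0 -[0](mulr0 a2) -hU; ring.
pose c := b0 * V0 + b1 * V1 + b2 * V2.
have yV0 : y * V0 = c * F0 + x * (b2 * U1 - b1 * U2).
  have -> : x * (b2 * U1 - b1 * U2) = b2 * (x * U1) - b1 * (x * U2) by ring.
  rewrite xU1 xU2 hy /c; ring.
have yV1 : y * V1 = c * F1 + x * (b0 * U2 - b2 * U0).
  have -> : x * (b0 * U2 - b2 * U0) = b0 * (x * U2) - b2 * (x * U0) by ring.
  rewrite xU0 xU2 hy /c; ring.
have yV2 : y * V2 = c * F2 + x * (b1 * U0 - b0 * U1).
  have -> : x * (b1 * U0 - b0 * U1) = b1 * (x * U0) - b0 * (x * U1) by ring.
  rewrite xU0 xU1 hy /c; ring.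
have [p [q hc]] : exists p q, c = x * p + y * q.
  apply: (rz c (- (e0 * (b2 * U1 - b1 * U2) + e1 * (b0 * U2 - b2 * U0)
                   + e2 * (b1 * U0 - b0 * U1)))
             (e0 * V0 + e1 * V1 + e2 * V2)).
  have -> : y * (e0 * V0 + e1 * V1 + e2 * V2) =
            e0 * (y * V0) + e1 * (y * V1) + e2 * (y * V2) by ring.
  rewrite yV0 yV1 yV2 hz; ring.
have [T0 hT0] : exists T, V0 - q * F0 = x * T.
  apply: (ry _ (p * F0 + (b2 * U1 - b1 * U2))).
  rewrite mulrBr yV0 hc; ring.
have [T1 hT1] : exists T, V1 - q * F1 = x * T.
  apply: (ry _ (p * F1 + (b0 * U2 - b2 * U0))).
  rewrite mulrBr yV1 hc; ring.
have [T2 hT2] : exists T, V2 - q * F2 = x * T.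
  apply: (ry _ (p * F2 + (b1 * U0 - b0 * U1))).
  rewrite mulrBr yV2 hc; ring.
have cancel u v w : x * u = v -> v = x * w -> u = w.
  move=> uv vw; apply/eqP; rewrite -subr_eq0; apply/eqP/rx.
  by rewrite mulrBr uv vw subrr.
exists T0, T1, T2; split.
- apply: (cancel _ _ _ xU0).
  have -> : x * (F1 * T2 - F2 * T1) = F1 * (x * T2) - F2 * (x * T1) by ring.
  rewrite -hT1 -hT2; ring.
- apply: (cancel _ _ _ xU1).
  have -> : x * (F2 * T0 - F0 * T2) = F2 * (x * T0) - F0 * (x * T2) by ring.
  rewrite -hT0 -hT2; ring.
- apply: (cancel _ _ _ xU2).
  have -> : x * (F0 * T1 - F1 * T0) = F0 * (x * T1) - F1 * (x * T0) by ring.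
  rewrite -hT0 -hT1; ring.
Qed.

Lemma varpow_regular3 (K : fieldType) n (i k l : 'I_n) N : uniq [:: i; k; l] ->
  regular3 ('X_i ^+ N : {mpoly K[n]}) ('X_k ^+ N) ('X_l ^+ N).
Proof.
rewrite /= !inE negb_or !andbT => /andP[/andP[/negPf ik /negPf il] /negPf kl].
have sum1 (p : 'I_n -> {mpoly K[n]}) :
    \sum_(j | pred1 i j) 'X_j ^+ N * p j = 'X_i ^+ N * p i.
  by rewrite big_pred1_eq.
have sum2 (p : 'I_n -> {mpoly K[n]}) :
    \sum_(j | pred2 i k j) 'X_j ^+ N * p j =
    'X_i ^+ N * p i + 'X_k ^+ N * p k.
  rewrite (bigD1 i) /= ?eqxx // (big_pred1 k) // => j /=.
  by case: (eqVneq j i) => [->|]; rewrite ?ik //= andbT.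
split.
- move=> c /eqP; rewrite mulf_eq0 mpolyXn => /orP[|/eqP //].
  move=> /eqP /(congr1 (mcoeff (U_(i) *+ N))) /eqP.
  by rewrite mcoeffX eqxx mcoeff0 oner_eq0.
- move=> c p; rewrite -(sum1 (fun=> p)) => /varpow_regular [|q ->].
    by rewrite /= eq_sym ik.
  by exists (q i); rewrite sum1.
- move=> c p q hc.
  have [||r ->] :=
    @varpow_regular _ _ (pred2 i k) N l c (fun j => if j == i then p else q).
  + by rewrite /= ![l == _]eq_sym il kl.
  + by rewrite sum2 eqxx eq_sym ik.
  by exists (r i), (r k); rewrite sum2.
Qed.

(** The coefficients of a relation lie in the ideal of the forms by [koszul],
    while their degree is too small for that. *)
Lemma no_small_syzygy (K : closedFieldType) d e (F U : 'I_3 -> {mpoly K[3]}) :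
  (forall j, F j \is d.-homog) ->
  (forall v, proj_point v -> exists j, (F j).@[v] != 0) ->
  (forall j, U j \is e.-homog) -> (e < d)%N ->
  \sum_j U j * F j = 0 -> forall j, U j = 0.
Proof.
move=> hF nz hU ed.
pose o1 : 'I_3 := inord 1; pose o2 : 'I_3 := inord 2.
have sum3 (a : 'I_3 -> {mpoly K[3]}) :
    \sum_j a j * F j = a ord0 * F ord0 + a o1 * F o1 + a o2 * F o2.
  rewrite !big_ord_recl big_ord0 addr0 addrA.
  have -> : lift ord0 ord0 = o1 by apply: val_inj; rewrite /= inordK.
  have -> // : lift ord0 (lift ord0 ord0) = o2.
  by apply: val_inj; rewrite /= inordK.
rewrite sum3 => syz.
have [N hN] := var_power_in_ideal hF nz.
have inI i : exists a0 a1 a2,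
    'X_i ^+ N = a0 * F ord0 + a1 * F o1 + a2 * F o2.
  by have [a ->] := hN i; exists (a ord0), (a o1), (a o2).
have u : uniq [:: ord0; o1; o2] by rewrite /= !inE -!val_eqE /= !inordK.
have [T0 [T1 [T2 [U0 U1 U2]]]] :=
  koszul (varpow_regular3 K N u) (inI _) (inI _) (inI _) syz.
have small j (a : 'I_3 -> {mpoly K[3]}) : U j = \sum_j a j * F j -> U j = 0.
  exact: dhomog_ideal_small (hF) (hU j) ed.
pose vec a0 a1 a2 (j : 'I_3) : {mpoly K[3]} :=
  if j == ord0 then a0 else if j == o1 then a1 else a2.
have vecE a0 a1 a2 : \sum_j vec a0 a1 a2 j * F j =
    a0 * F ord0 + a1 * F o1 + a2 * F o2.
  by rewrite sum3 /vec -!val_eqE /= !inordK.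
have U0z : U ord0 = 0.
  by apply: (small _ (vec 0 T2 (- T1))); rewrite vecE U0; ring.
have U1z : U o1 = 0.
  by apply: (small _ (vec (- T2) 0 T0)); rewrite vecE U1; ring.
have U2z : U o2 = 0.
  by apply: (small _ (vec T1 (- T0) 0)); rewrite vecE U2; ring.
move=> j; have : j \in [:: ord0; o1; o2].
  by case: j => -[|[|[|//]]] hj; rewrite !inE -!val_eqE /= ?inordK.
by rewrite !inE => /or3P[] /eqP ->.
Qed.

(** * The degree bound *)

Lemma msize_mderiv n (K : fieldType) (p : {mpoly K[n]}) j :
  (msize p^`M(j) <= (msize p).-1)%N.
Proof.
rewrite [X in (X <= _)%N]msizeE; apply/bigmax_leqP_seq => m.
rewrite mcoeff_msupp mcoeff_deriv => pm _.
have mp : (m + U_(j))%MM \in msupp p.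
  by rewrite mcoeff_msupp; apply: contraNneq pm => ->; rewrite mul0rn.
by have := msize_mdeg_lt mp; rewrite mdegD mdeg1 addn1; case: (msize p).
Qed.

Section Main.
Variable K : closedFieldType.
Hypothesis K0 : [pchar K] =i pred0.

Let mulrn_eq0_char0 n (k : nat) (p : {mpoly K[n]}) :
  (0 < k)%N -> p *+ k = 0 -> p = 0.
Proof.
move=> k0 /eqP; rewrite -mulr_natl -mpolyC_nat mul_mpolyC => /eqP pk.
apply/mpolyP => m; have /eqP := congr1 (mcoeff m) pk.
rewrite mcoeffZ mcoeff0 mulf_eq0 => /orP[|/eqP //].
by rewrite ((pcharf0P K).1 K0) -leqn0 leqNgt k0.
Qed.

(** By Euler's identity and characteristic 0, a common zero of the partial
    derivatives lies on the curve, hence is a singular point of it. *)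
Lemma smooth_gradient (f : {mpoly K[2]}) v :
  (0 < mdegree f)%N -> smooth_curve f -> proj_point v ->
  exists j, (homogenization f)^`M(j).@[v] != 0.
Proof.
move=> n0 sm pv; set F := homogenization f.
have [/existsP //|/existsPn H] := boolP [exists j, F^`M(j).@[v] != 0].
have H0 j : F^`M(j).@[v] = 0 by apply/eqP; have := H j; rewrite negbK.
case: (sm v); split=> //; split=> //.
have /(congr1 (meval v)) := euler_dhomog (homogenization_homog f).
rewrite raddf_sum big1 => [/esym/eqP|j _]; last by rewrite /= mevalM H0 mulr0.
rewrite mevalMn -mulr_natl mulf_eq0 ((pcharf0P K).1 K0) => /orP[|/eqP //].
by rewrite -leqn0 leqNgt n0.
Qed.

Lemma cofactor_msize (P Q f k : {mpoly K[2]}) m :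
  f != 0 -> (msize P <= m.+1)%N -> (msize Q <= m.+1)%N ->
  P * f^`M(ord0) + Q * f^`M(ord_max) = k * f -> (msize k <= m)%N.
Proof.
move=> f0 hP hQ hk.
have [->|k0] := eqVneq k 0; first by rewrite msize0.
have sf : (0 < msize f)%N by rewrite lt0n msize_poly_eq0.
have bound p j : (msize p <= m.+1)%N ->
    (msize (p * f^`M(j)) <= m + (msize f).-1)%N.
  move=> hp; have [->|p0] := eqVneq p 0; first by rewrite mul0r msize0.
  have [->|fj0] := eqVneq f^`M(j) 0; first by rewrite mulr0 msize0.
  rewrite msizeM //; have := leq_add hp (msize_mderiv f j); rewrite addSn.
  by case: (_ + msize _)%N.
have : (msize (k * f) <= m + (msize f).-1)%N.
  by rewrite -hk; apply: leq_trans (msizeD_le _ _) _; rewrite geq_max !bound.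
by rewrite msizeM // -{1}(prednK sf) addnS /= leq_add2r.
Qed.

(** The affine invariance relation is lifted to forms by [dehom_inj]; combined
    with Euler's identity, it becomes a relation between the partial derivatives
    of the homogenization, with coefficients of degree [m]. *)
Lemma smooth_invariant_degree (P Q f : {mpoly K[2]}) m :
  (0 < m)%N -> maxn (mdegree P) (mdegree Q) = m -> invariant_curve P Q f ->
  smooth_curve f -> (mdegree f <= m.+1)%N.
Proof.
move=> m0 hm [[f0 _] [k hk]] sm; rewrite leqNgt; apply/negP => mn.
set n := mdegree f in mn f0.
have [d nd] : exists d, n = d.+1 by exists n.-1; rewrite prednK.
rewrite nd ltnS in mn.
have sz p : (mdegree p <= m)%N -> (msize p <= m.+1)%N.
  by move=> hp; apply: leq_trans (leqSpred _) _.
have sP : (msize P <= m.+1)%N by apply: sz; rewrite -hm leq_maxl.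
have sQ : (msize Q <= m.+1)%N by apply: sz; rewrite -hm leq_maxr.
have fn0 : f != 0 by apply: contraTneq f0 => f0; rewrite /n /mdegree f0 msize0.
have sk := cofactor_msize fn0 sP sQ hk.
pose F := homogenization f.
have hF : F \is d.+1.-homog by rewrite -nd; exact: homogenization_homog.
pose x : 'I_3 := widen_ord (leqnSn 2) ord0.
pose y : 'I_3 := widen_ord (leqnSn 2) ord_max.
pose z : 'I_3 := ord_max.
pose A := homog_at z m (mwiden P).
pose B := homog_at z m (mwiden Q).
pose G := homog_at z m.-1 (mwiden k).
have hA : A \is m.-homog by exact/homog_at_homog/(leq_trans (msize_mwiden _)).
have hB : B \is m.-homog by exact/homog_at_homog/(leq_trans (msize_mwiden _)).
have hG : G \is m.-1.-homog.
  apply: homog_at_homog; rewrite prednK //.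
  exact: leq_trans (msize_mwiden _) _.
have rel : A * F^`M(x) + B * F^`M(y) = G * F.
  apply/eqP; rewrite -subr_eq0; apply/eqP; apply: (@dehom_inj _ _ z (m + d)).
    apply: rpredB.
      by apply: rpredD; apply: dhomogM => //; exact: dhomog_mderiv.
    have -> : (m + d = m.-1 + d.+1)%N by rewrite addnS -addSn prednK.
    exact: dhomogM.
  rewrite rmorphB rmorphD !rmorphM /= !dehom_homog_at !dehom_mwiden.
  rewrite !dehom_mderiv // dehom_homogenization !mderiv_mwiden.
  by rewrite -!rmorphM -rmorphD -rmorphB /= hk subrr mwiden0.
pose V j := if j == x then A else if j == y then B else 0.
pose U j := V j *+ n - 'X_j * G.
have UF : \sum_j U j * F^`M(j) = 0.
  have -> : \sum_j U j * F^`M(j) =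
      (\sum_j V j * F^`M(j)) *+ n - (\sum_j 'X_j * F^`M(j)) * G.
    rewrite -sumrMnl mulr_suml -sumrB; apply: eq_bigr => j _.
    by rewrite /U mulrBl mulrnAl mulrAC.
  rewrite (euler_dhomog hF) -nd mulrnAl mulrC -rel.
  rewrite (bigD1 x) //= (bigD1 y) //= big1 => [|j /andP[/negPf jx /negPf jy]].
    by rewrite /V !eqxx addr0 subrr.
  by rewrite /V jx jy mul0r.
have hV j : V j \is m.-homog.
  by rewrite /V; do 2!case: ifP => _ //; exact: dhomog0.
have hU j : U j \is m.-homog.
  apply: rpredB; first exact: rpredMn.
  have -> : m = (1 + m.-1)%N by rewrite add1n prednK.
  by apply: dhomogM => //; rewrite dhomogX /= mdeg1.
have U0 := no_small_syzygy (fun j => dhomog_mderiv j hF)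
             (fun v => smooth_gradient f0 sm) hU mn UF.
have G0 : G = 0.
  have /eqP := U0 z; rewrite /U /V /= mul0rn sub0r oppr_eq0 mulf_eq0.
  case/orP => /eqP // /(congr1 (mcoeff U_(z))) /eqP.
  by rewrite mcoeffX eqxx mcoeff0 oner_eq0.
have V0 j : V j = 0.
  by apply: (mulrn_eq0_char0 f0); have := U0 j; rewrite /U G0 mulr0 subr0.
have P0 : P = 0.
  apply/inj_mwiden; rewrite mwiden0 -dehom_mwiden -(dehom_homog_at _ m) -/A.
  by rewrite (V0 x : A = 0) rmorph0.
have Q0 : Q = 0.
  apply/inj_mwiden; rewrite mwiden0 -dehom_mwiden -(dehom_homog_at _ m) -/B.
  by rewrite (V0 y : B = 0) rmorph0.
by move: m0; rewrite -hm P0 Q0 /mdegree msize0.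
Qed.
End Main.

Local Close Scope ring_scope.

Theorem theorem2 (R : realType) (P Q f : {mpoly R[i][2]}) (m n : nat)
  (hm : 1 < m)
  (hPQ : maxn (mdegree P) (mdegree Q) = m)
  (hcop : no_common_factor P Q)
  (hC : invariant_curve P Q f)
  (hsmooth : smooth_curve f)
  (hf : mdegree f = n) :
  n <= m.+1.
Proof.
rewrite -hf; apply: smooth_invariant_degree hPQ hC hsmooth; last exact: ltnW.
exact: Num.Theory.pchar_num.
Qed.
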